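(* The $5$-dimensional Heisenberg group $$H_5=\langle x,y,u,v,z \mid [x,y]=[u,v]=z,\ \text{all other pairs of generators commute}\rangle$$ is IIPP and irreducible.
   Context: An infinite group $\Gamma$ is infinite-index presentable by products (IIPP) if there is a homomorphism $\varphi\colon\Gamma_1\times\Gamma_2\to\Gamma$ onto a finite index subgroup of $\Gamma$ such that both images $\varphi(\Gamma_1),\varphi(\Gamma_2)$ have infinite index in $\Gamma$. A group is reducible if it has a finite index subgroup isomorphic to a direct product of two infinite groups, and irreducible otherwise. *)

(* Defs.v *)
From HB Require Import structures.
From mathcomp Require Import all_boot.
From mathcomp Require Import all_classical.

Set Implicit Arguments.
Unset Strict Implicit.
Unset Printing Implicit Defensive.

Local Open Scope classical_set_scope.
Local Open Scope quotient_scope.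
Local Open Scope group_scope.

(* Groups given by generators and relations. A letter (a, false) stands for   *)
(* the generator a and (a, true) for its formal inverse; the presented group  *)
(* is the quotient of the words by the congruence generated by free           *)
(* cancellation and by the defining relations s = t, (s, t) \in rels.         *)

Definition word (X : Type) : Type := seq (X * bool).

Definition word_gen (X : Type) (a : X) : word X := [:: (a, false)].

Definition word_inv (X : Type) (s : word X) : word X :=
  rev [seq (l.1, ~~ l.2) | l <- s].

(* [~ s, t] = s^-1 t^-1 s t. In H5 below the commutators are central, so the   *)
(* convention s t s^-1 t^-1 would define the same group.                      *)
Definition word_comm (X : Type) (s t : word X) : word X :=
  word_inv s ++ (word_inv t ++ (s ++ t)).

Section Presentation.
Variables (X : choiceType) (rels : seq (word X * word X)).

Inductive word_cong : word X -> word X -> Prop :=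
| word_cong_rel s t : (s, t) \in rels -> word_cong s t
| word_cong_cancel a b : word_cong [:: (a, b); (a, ~~ b)] [::]
| word_cong_cat s1 t1 s2 t2 :
    word_cong s1 t1 -> word_cong s2 t2 -> word_cong (s1 ++ s2) (t1 ++ t2)
| word_cong_refl s : word_cong s s
| word_cong_sym s t : word_cong s t -> word_cong t s
| word_cong_trans s t u : word_cong s t -> word_cong t u -> word_cong s u.

Definition word_congb : rel (word X) := fun s t => `[< word_cong s t >].

Fact word_congb_refl : reflexive word_congb.
Proof. by move=> s; apply/asboolP; exact: word_cong_refl. Qed.

Fact word_congb_sym : symmetric word_congb.
Proof. by move=> s t; apply/asboolP/asboolP; exact: word_cong_sym. Qed.

Fact word_congb_trans : transitive word_congb.
Proof.
move=> t s u /asboolP st /asboolP tu.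
by apply/asboolP; exact: word_cong_trans st tu.
Qed.

Canonical word_cong_equiv :=
  EquivRel word_congb word_congb_refl word_congb_sym word_congb_trans.

Definition presented_group : Type := {eq_quot word_cong_equiv}.

HB.instance Definition _ := Choice.on presented_group.
HB.instance Definition _ := EqQuotient.on presented_group.

Definition pres_class (s : word X) : presented_group := \pi_presented_group s.

Definition pres_one : presented_group := pres_class [::].
Definition pres_mul (g h : presented_group) : presented_group :=
  pres_class (repr g ++ repr h).
Definition pres_inv (g : presented_group) : presented_group :=
  pres_class (word_inv (repr g)).

Lemma pres_classK : cancel repr pres_class.
Proof. exact: reprK. Qed.

Lemma pres_classP s t : pres_class s = pres_class t <-> word_cong s t.
Proof.
by split=> [/eqmodP/asboolP|st] //; apply/eqmodP/asboolP.
Qed.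

Lemma repr_pres_class s : word_cong (repr (pres_class s)) s.
Proof. by apply/pres_classP; exact: pres_classK. Qed.

Lemma pres_mulE s t :
  pres_mul (pres_class s) (pres_class t) = pres_class (s ++ t).
Proof. by apply/pres_classP; apply: word_cong_cat; exact: repr_pres_class. Qed.

Lemma word_inv_cat (s t : word X) :
  word_inv (s ++ t) = word_inv t ++ word_inv s.
Proof. by rewrite /word_inv map_cat rev_cat. Qed.

Lemma word_invK : involutive (@word_inv X).
Proof.
move=> s; rewrite /word_inv map_rev revK mapK //.
by case=> a b /=; rewrite negbK.
Qed.

Lemma word_congV s : word_cong (s ++ word_inv s) [::].
Proof.
elim: s => [|[a b] s IHs]; first exact: word_cong_refl.
rewrite -cat1s word_inv_cat -catA (catA s).
apply: word_cong_trans (word_cong_cancel a b).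
apply: (@word_cong_cat [:: (a, b)] _ _ _ (word_cong_refl _)).
rewrite -[X in word_cong _ X]cat0s.
exact: word_cong_cat IHs (word_cong_refl _).
Qed.

Fact pres_mulA : associative pres_mul.
Proof.
move=> g h k; rewrite -(pres_classK g) -(pres_classK h) -(pres_classK k).
by rewrite !pres_mulE catA.
Qed.

Fact pres_mul1 : left_id pres_one pres_mul.
Proof. by move=> g; rewrite -[g in LHS]pres_classK pres_mulE; exact: pres_classK. Qed.

Fact pres_mulg1 : right_id pres_one pres_mul.
Proof. by move=> g; rewrite -[g in LHS]pres_classK pres_mulE cats0; exact: pres_classK. Qed.

Fact pres_mulV : left_inverse pres_one pres_inv pres_mul.
Proof.
move=> g; rewrite -[X in pres_mul _ X]pres_classK pres_mulE; apply/pres_classP.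
by rewrite -{2}(word_invK (repr g)); exact: word_congV.
Qed.

Fact pres_mulgV : right_inverse pres_one pres_inv pres_mul.
Proof.
move=> g; rewrite -[X in pres_mul X _]pres_classK pres_mulE; apply/pres_classP.
exact: word_congV.
Qed.

HB.instance Definition _ := isGroup.Build presented_group
  pres_mulA pres_mul1 pres_mulg1 pres_mulV pres_mulgV.

End Presentation.

(* The indices 0, 1, 2, 3, 4 of the generators stand for x, y, u, v, z. *)
Definition H5_rels : seq (word 'I_5 * word 'I_5) :=
  let x := word_gen (inord 0) in
  let y := word_gen (inord 1) in
  let u := word_gen (inord 2) in
  let v := word_gen (inord 3) in
  let z := word_gen (inord 4) in
  [:: (word_comm x y, z); (word_comm u v, z);
      (word_comm x u, [::]); (word_comm x v, [::]);
      (word_comm y u, [::]); (word_comm y v, [::]);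
      (word_comm x z, [::]); (word_comm y z, [::]);
      (word_comm u z, [::]); (word_comm v z, [::])].

Definition H5 : groupType := presented_group H5_rels.

Definition left_cosets (G : groupType) (K : set G) : set (set G) :=
  [set [set g * k | k in K] | g in [set: G]].

Definition finite_index (G : groupType) (K : set G) : Prop :=
  finite_set (left_cosets K).

Definition infinite_group (G : groupType) : Prop := infinite_set [set: G].

Definition IIPP (G : groupType) : Prop :=
  infinite_group G /\
  exists (G1 G2 : groupType) (phi : {multiplicative G1 * G2 -> G}),
    [/\ finite_index (range phi),
        ~ finite_index [set phi (g1, 1) | g1 in [set: G1]] &
        ~ finite_index [set phi (1, g2) | g2 in [set: G2]]].

Definition reducible (G : groupType) : Prop :=
  exists K : set G, [/\ group_closed (mem K), finite_index K &
    exists (G1 G2 : groupType) (psi : {multiplicative G1 * G2 -> G}),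
      [/\ infinite_group G1, infinite_group G2 & set_bij [set: G1 * G2] K psi]].

Definition irreducible (G : groupType) : Prop := ~ reducible G.

(* Main.v *)
From HB Require Import structures.
From mathcomp Require Import all_boot all_algebra ring zify.
From mathcomp Require Import all_classical.
Require Import Defs.

(** [H5] is a central extension of Z^4 by the infinite cyclic group generated
by z, and the commutator of two elements is z raised to the value of the
standard symplectic form on their images in Z^4. The plane spanned by x, y and
the plane spanned by u, v are orthogonal for this form; this gives the first
half of the theorem, and nondegeneracy of the form gives the second.

Presentability by products: since x and y commute with u and v, two free groups
of rank 2, the first mapped to x, y and the second to u, v, define a
homomorphism from their product to [H5]. It is onto, because z = [x, y]. The
exponent of u is a homomorphism to Z that kills the first image and takes the
value 1 at u, so that image has infinite index ([char_infinite_index]); the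
exponent of x does the same for the second image.

Irreducibility: suppose that a finite index subgroup K is the direct product of
infinite subgroups A and B. Each of them contains a nontrivial power of z
([factor_meets_center]). Indeed, if A is not abelian, then a nontrivial
commutator of A is a power of z. If A is abelian, then any nontrivial element
of A is central in K. As K contains positive powers of x, y, u and v, such an
element is orthogonal to a basis of Q^4, hence is a power of z
([centralizer_finite_index]). Two nontrivial powers of z have a common
nontrivial multiple, which lies in both A and B: a contradiction.

The computations take place in an explicit group [heis] on Z^5. The map
[coords] from [H5] to [heis] comes from the universal property of the
presentation, and its existence shows that z has infinite order in [H5]. It is
injective because every element of [H5] can be brought into the form
x^a y^b u^c v^d z^e ([coordsK]), so that equalities in [H5] can be checked in
[heis]. *)

Set Implicit Arguments.
Unset Strict Implicit.
Unset Printing Implicit Defensive.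

Import GRing.Theory Num.Theory.

Local Open Scope classical_set_scope.
Local Open Scope group_scope.

(** * Homomorphisms, integer powers and characters *)

Section Morphisms.
Variables (G H : groupType) (f : G -> H).
Hypothesis fM : {morph f : x y / x * y}.

Lemma morph_group1 : f 1 = 1.
Proof. by apply: (@mulgI _ (f 1)); rewrite -fM !mulg1. Qed.

Lemma morph_groupV : {morph f : x / x^-1}.
Proof.
by move=> x; apply: (@mulgI _ (f x)); rewrite -fM !mulgV morph_group1.
Qed.

Lemma morph_groupX n : {morph f : x / x ^+ n}.
Proof.
by move=> x; elim: n => [|n IHn]; rewrite ?morph_group1 // !expgS fM IHn.
Qed.

End Morphisms.

Section IntegerPowers.
Variable G : groupType.
Implicit Types (g h : G) (m n : int).

Definition expz g n : G :=
  match n with Posz k => g ^+ k | Negz k => g ^- k.+1 end.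

Lemma expzS g n : expz g (n + 1)%R = g * expz g n.
Proof.
case: n => [n|[|n]].
- by rewrite -PoszD addn1 /= expgS.
- by rewrite /= mulgV.
- have -> : (Negz n.+1 + 1)%R = Negz n by rewrite !NegzE; lia.
  by rewrite /= [in RHS]expgSr invgM mulVKg.
Qed.

Lemma expzB1 g n : expz g (n - 1)%R = g^-1 * expz g n.
Proof. by rewrite -[n in RHS](subrK 1%R) expzS mulKg. Qed.

Lemma expzD g m n : expz g (m + n)%R = expz g m * expz g n.
Proof.
elim/ssrint.int_rect: m => [|m IHm|m IHm]; first by rewrite add0r mul1g.
- have -> : (m.+1%:Z + n = m%:Z + n + 1)%R by lia.
  have -> : (m.+1%:Z = m%:Z + 1)%R by lia.
  by rewrite !expzS IHm mulgA.
- have -> : (- m.+1%:Z + n = - m%:Z + n - 1)%R by lia.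
  have -> : (- m.+1%:Z = - m%:Z - 1)%R by lia.
  by rewrite !expzB1 IHm mulgA.
Qed.

Lemma commute_expz g h n : commute g h -> commute g (expz h n).
Proof.
by move=> gh; case: n => n; [|apply: commuteV]; exact: commuteX.
Qed.

Lemma expzMn g h n : commute g h -> expz (g * h) n = expz g n * expz h n.
Proof.
move=> gh; case: n => n; rewrite /= expgMn // invgM.
apply: commute_sym; apply: commuteV; apply: commute_sym; apply: commuteV.
exact: commuteX2.
Qed.

End IntegerPowers.

Lemma morph_expz (G H : groupType) (f : G -> H) n :
  {morph f : x y / x * y} -> {morph f : g / expz g n}.
Proof.
by move=> fM g; case: n => n; rewrite /= ?morph_groupV // morph_groupX.
Qed.

Section Characters.
Variables (G : groupType) (chi : G -> int).
Hypothesis chiM : forall g h, chi (g * h) = (chi g + chi h)%R.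

Lemma char1 : chi 1 = 0%R.
Proof. by apply: (@addrI _ (chi 1)); rewrite -chiM mulg1 addr0. Qed.

Lemma charV g : chi g^-1 = (- chi g)%R.
Proof. by apply: (@addrI _ (chi g)); rewrite -chiM mulgV subrr char1. Qed.

Lemma charX g n : chi (g ^+ n) = (chi g *+ n)%R.
Proof.
by elim: n => [|n IHn]; rewrite ?char1 // expgS mulrS chiM IHn.
Qed.

End Characters.

(** * Subgroups of finite index *)

Section FiniteIndex.
Variable G : groupType.
Implicit Types K : set G.

Lemma coset_pigeonhole K g : finite_index K ->
  exists i j, (i < j)%N /\
    [set g ^+ i * k | k in K] = [set g ^+ j * k | k in K].
Proof.
move=> finK; apply: contrapT => nocoll; apply: infinite_nat.
pose c i := [set g ^+ i * k | k in K].
have c_inj : injective c.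
  move=> i j cij; case: (ltngtP i j) => // ltij; case: nocoll.
    by exists i, j.
  by exists j, i; split => //; rewrite -/(c i) -/(c j).
rewrite [setT](_ : _ = c @^-1` left_cosets K).
  by apply: finite_preimage => // i j _ _; exact: c_inj.
by apply/esym/seteqP; split=> // i _; exists (g ^+ i).
Qed.

(** The cosets of the powers of [g] cannot all be distinct, and
    [g ^+ i * K = g ^+ j * K] puts [g ^+ (j - i)] in [K]. *)
Lemma finite_index_expg K g : group_closed (mem K) -> finite_index K ->
  exists2 n, (0 < n)%N & K (g ^+ n).
Proof.
move=> [K1 _] /(coset_pigeonhole g)[i [j [ltij cij]]].
have : [set g ^+ i * k | k in K] (g ^+ j).
  by rewrite cij; exists 1; rewrite ?mulg1 //; exact: set_mem.
case=> k Kk gk; exists (j - i)%N; first by rewrite subn_gt0.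
suff -> : g ^+ (j - i) = k by [].
by apply: (@mulgI _ (g ^+ i)); rewrite -expgnDr subnKC // ltnW.
Qed.

(** The character [chi] is constant on each coset of [K] and takes infinitely
    many values on the powers of [g]. Taking [K] to be trivial, this also shows
    that [G] is infinite. *)
Lemma char_infinite_index (chi : G -> int) K g :
    (forall g h, chi (g * h) = (chi g + chi h)%R) ->
    K 1 -> (forall k, K k -> chi k = 0%R) -> chi g = 1%R ->
  ~ finite_index K.
Proof.
move=> chiM K1 chiK chig /(coset_pigeonhole g)[i [j [ltij cij]]].
have : [set g ^+ j * k | k in K] (g ^+ i).
  by rewrite -cij; exists 1; rewrite ?mulg1.
case=> k Kk /(congr1 chi); rewrite chiM !(charX chiM) chig (chiK k Kk) addr0.
by rewrite !pmulrn !intz => -[eij]; move: ltij; rewrite eij ltnn.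
Qed.

End FiniteIndex.

(** * Groups given by generators and relations *)

Section WordEvaluation.
Variables (X : choiceType) (G : groupType) (f : X -> G).

Definition letter_eval (l : X * bool) : G := if l.2 then (f l.1)^-1 else f l.1.
Definition word_eval (s : word X) : G :=
  foldr (fun l g => letter_eval l * g) 1 s.

Lemma word_eval_cat s t : word_eval (s ++ t) = word_eval s * word_eval t.
Proof. by elim: s => [|l s IHs] /=; rewrite ?mul1g // IHs mulgA. Qed.

Lemma word_eval_inv s : word_eval (word_inv s) = (word_eval s)^-1.
Proof.
elim: s => [|[a b] s IHs]; first by rewrite invg1.
rewrite -cat1s word_inv_cat !word_eval_cat IHs invgM; congr (_ * _).
by rewrite /word_eval /= !mulg1; case: b; rewrite /letter_eval //= invgK.
Qed.

Lemma word_eval_comm s t :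
  word_eval (word_comm s t) = [~ word_eval s, word_eval t].
Proof. by rewrite !word_eval_cat !word_eval_inv. Qed.

Lemma word_eval_gen a : word_eval (word_gen a) = f a.
Proof. exact: mulg1. Qed.

(** Evaluations of words stay in the subgroup generated by the [f a], seen here
    as the smallest predicate closed under the group operations. *)
Lemma word_eval_ind (P : G -> Prop) :
    P 1 -> (forall g h, P g -> P h -> P (g * h)) ->
    (forall g, P g -> P g^-1) -> (forall a, P (f a)) ->
  forall s, P (word_eval s).
Proof.
move=> P1 PM PV Pf; elim=> [|[a b] s IHs] //=; apply: PM => //.
by case: b; rewrite /letter_eval /=; [apply: PV|]; exact: Pf.
Qed.

Variable rels : seq (word X * word X).

Definition pres_lift (g : presented_group rels) : G := word_eval (repr g).

Hypothesis f_rels : forall s t, (s, t) \in rels -> word_eval s = word_eval t.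

(** Von Dyck's theorem: images of the generators that satisfy the relations
    define a homomorphism. *)
Lemma word_eval_cong s t : word_cong rels s t -> word_eval s = word_eval t.
Proof.
elim=> {s t} [s t /f_rels||s1 t1 s2 t2 _ e1 _ e2|||s t u _ -> _ ->] //.
- by move=> a [] /=; rewrite /letter_eval /= mulg1 ?mulgV ?mulVg.
- by rewrite !word_eval_cat e1 e2.
Qed.

Lemma pres_lift_class s : pres_lift (pres_class rels s) = word_eval s.
Proof. by apply: word_eval_cong; exact: repr_pres_class. Qed.

Lemma pres_liftM : {morph pres_lift : g h / g * h}.
Proof.
by move=> g h; rewrite [LHS]pres_lift_class word_eval_cat.
Qed.

End WordEvaluation.

Section PresentedGroup.
Variables (X : choiceType) (rels : seq (word X * word X)).
Local Notation G := (presented_group rels).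

Definition pres_gen (a : X) : G := pres_class rels (word_gen a).

Lemma word_eval_pres_gen s : word_eval pres_gen s = pres_class rels s.
Proof.
elim: s => [|[a b] s IHs] //=.
rewrite IHs -cat1s -pres_mulE; congr (_ * _).
case: b => //; apply: mulg1_eq.
rewrite [LHS]pres_mulE; apply/pres_classP; exact: word_cong_cancel.
Qed.

Lemma pres_rel s t :
  (s, t) \in rels -> word_eval pres_gen s = word_eval pres_gen t.
Proof.
by move=> st; rewrite !word_eval_pres_gen; apply/pres_classP/word_cong_rel.
Qed.

Lemma pres_group_ind (P : G -> Prop) :
    P 1 -> (forall g h, P g -> P h -> P (g * h)) ->
    (forall g, P g -> P g^-1) -> (forall a, P (pres_gen a)) ->
  forall g, P g.
Proof.
move=> P1 PM PV Pgen g; rewrite -[g]pres_classK -word_eval_pres_gen.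
exact: word_eval_ind.
Qed.

End PresentedGroup.

(** * The Heisenberg group in coordinates *)

(** [Heis a b c d e] stands for x^a y^b u^c v^d z^e. *)
Record heis := Heis { hx : int; hy : int; hu : int; hv : int; hz : int }.

Definition heis_tuple s := (hx s, hy s, hu s, hv s, hz s).
Definition tuple_heis t := let: (a, b, c, d, e) := t in Heis a b c d e.

Lemma heis_tupleK : cancel heis_tuple tuple_heis.
Proof. by case. Qed.

HB.instance Definition _ := Choice.copy heis (can_type heis_tupleK).

Section HeisGroup.
Local Open Scope ring_scope.
Implicit Types s t : heis.

Definition heis_one := Heis 0 0 0 0 0.

(** Moving y^b past x^a' to the right produces z^(- b * a'), because
    [[x, y] = z] means [y * x = x * y * z^-1]; likewise for v and u. *)
Definition heis_mul s t :=
  Heis (hx s + hx t) (hy s + hy t) (hu s + hu t) (hv s + hv t)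
       (hz s + hz t - hy s * hx t - hv s * hu t).
Definition heis_inv s :=
  Heis (- hx s) (- hy s) (- hu s) (- hv s)
       (- hz s - hy s * hx s - hv s * hu s).

Fact heis_mulA : associative heis_mul.
Proof. by move=> s t r; rewrite /heis_mul /=; congr Heis; ring. Qed.

Fact heis_mul1 : left_id heis_one heis_mul.
Proof. by case=> *; rewrite /heis_mul /=; congr Heis; ring. Qed.

Fact heis_mulg1 : right_id heis_one heis_mul.
Proof. by case=> *; rewrite /heis_mul /=; congr Heis; ring. Qed.

Fact heis_mulV : left_inverse heis_one heis_inv heis_mul.
Proof. by case=> *; rewrite /heis_mul /=; congr Heis; ring. Qed.

Fact heis_mulgV : right_inverse heis_one heis_inv heis_mul.
Proof. by case=> *; rewrite /heis_mul /=; congr Heis; ring. Qed.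

HB.instance Definition _ := isGroup.Build heis
  heis_mulA heis_mul1 heis_mulg1 heis_mulV heis_mulgV.

Lemma heis_mulE s t : (s * t)%g = heis_mul s t. Proof. by []. Qed.

Lemma heis_invE s : (s^-1)%g = heis_inv s. Proof. by []. Qed.

Definition symp s t : int :=
  hx s * hy t - hy s * hx t + (hu s * hv t - hv s * hu t).

Lemma heis_commuteP s t : commute s t <-> symp s t = 0.
Proof.
rewrite /commute /symp; split => [/(congr1 hz) /= e|e]; first by lia.
by rewrite !heis_mulE /heis_mul; congr Heis; lia.
Qed.

Definition hcenter m := Heis 0 0 0 0 m.

Lemma hcenterP s : [/\ hx s = 0, hy s = 0, hu s = 0 & hv s = 0] ->
  s = hcenter (hz s).
Proof. by case: s => a b c d e [/= -> -> -> ->]. Qed.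

Lemma heis_commg s t : exists m, [~ s, t]%g = hcenter m.
Proof.
eexists; apply: hcenterP; split => /=; ring.
Qed.

Lemma hcenterM m n : hcenter (m + n) = (hcenter m * hcenter n)%g.
Proof. by rewrite heis_mulE /heis_mul /hcenter; congr Heis => /=; ring. Qed.

Lemma hcenterV m : hcenter (- m) = ((hcenter m)^-1)%g.
Proof. by rewrite heis_invE /heis_inv /hcenter; congr Heis => /=; ring. Qed.

Lemma expz_hcenter m n : expz (hcenter m) n = hcenter (m * n).
Proof.
have expg_hcenter k : (hcenter m ^+ k)%g = hcenter (m * k%:Z).
  elim: k => [|k IHk]; first by rewrite mulr0.
  by rewrite expgS IHk -hcenterM; congr hcenter; lia.
case: n => n; rewrite /expz expg_hcenter // -hcenterV; congr hcenter; lia.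
Qed.

End HeisGroup.

(** * Normal forms in the presented group *)

Local Notation gx := (pres_gen H5_rels (inord 0)).
Local Notation gy := (pres_gen H5_rels (inord 1)).
Local Notation gu := (pres_gen H5_rels (inord 2)).
Local Notation gv := (pres_gen H5_rels (inord 3)).
Local Notation gz := (pres_gen H5_rels (inord 4)).

Lemma ord5_ind (P : 'I_5 -> Prop) :
  P (inord 0) -> P (inord 1) -> P (inord 2) -> P (inord 3) -> P (inord 4) ->
  forall i, P i.
Proof.
move=> P0 P1 P2 P3 P4 i; rewrite -(inord_val i).
by case: i => [[|[|[|[|[|]]]]]].
Qed.

Definition heis_gen (i : 'I_5) : heis :=
  match val i with
  | 0 => Heis 1 0 0 0 0
  | 1 => Heis 0 1 0 0 0
  | 2 => Heis 0 0 1 0 0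
  | 3 => Heis 0 0 0 1 0
  | _ => Heis 0 0 0 0 1
  end.

Definition coords : H5 -> heis := pres_lift heis_gen (rels := H5_rels).

Lemma heis_gen_rels s t :
  (s, t) \in H5_rels -> word_eval heis_gen s = word_eval heis_gen t.
Proof.
move=> st; apply/eqP; move: st; rewrite !inE !xpair_eqE.
do ![case/orP]; case/andP=> /eqP-> /eqP->;
  by rewrite word_eval_comm ?word_eval_gen /heis_gen /= !inordK.
Qed.

Lemma coordsM : {morph coords : g h / g * h}.
Proof. exact/pres_liftM/heis_gen_rels. Qed.

Lemma coords_gen i : coords (pres_gen H5_rels i) = heis_gen i.
Proof.
by rewrite /coords [LHS]pres_lift_class ?word_eval_gen //; exact: heis_gen_rels.
Qed.

Lemma H5_comm i j (w : word 'I_5) :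
  (word_comm (word_gen i) (word_gen j), w) \in H5_rels ->
  [~ pres_gen H5_rels i, pres_gen H5_rels j] = word_eval (pres_gen H5_rels) w.
Proof. by move/pres_rel => <-; rewrite word_eval_comm !word_eval_gen. Qed.

Lemma H5_commute i j :
  (word_comm (word_gen i) (word_gen j), [::]) \in H5_rels ->
  commute (pres_gen H5_rels i) (pres_gen H5_rels j).
Proof. by move/H5_comm/eqP/commgP. Qed.

Definition normal_form (s : heis) : H5 :=
  expz gx (hx s) * expz gy (hy s) * expz gu (hu s) * expz gv (hv s) *
  expz gz (hz s).

(** Conjugation by [b] sends [a] to [a * c], hence [expz a n] to
    [expz a n * expz c n]. For the pairs y, x and v, u of [H5] this is the
    step that produces powers of z when a word is put into normal form. *)
Lemma swap_expz (G : groupType) (a b c : G) n :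
  commute a c -> commute b c -> [~ a, b] = c ->
  b * expz a n = expz a n * b * expz c (- n)%R.
Proof.
move=> ac bc abc.
have aJb : a ^ b = a * c by rewrite -abc commgEl mulVKg.
have conj : expz a n * b = b * (expz a n * expz c n).
  rewrite conjgC (morph_expz (f := fun g => conjg g b)) ?aJb ?expzMn //.
  by move=> g h; exact: conjMg.
by rewrite conj -!mulgA -expzD subrr mulg1.
Qed.

(** Collection in [H5]: the new generator is moved to its place in the normal
    form, and the correction in z that this costs is the one in [heis_mul]. *)
Lemma normal_form_gen i t :
  normal_form (heis_gen i * t) = pres_gen H5_rels i * normal_form t.
Proof.
have xy : [~ gx, gy] = gz.
  rewrite -[RHS](word_eval_gen (pres_gen H5_rels)).
  by apply: H5_comm; rewrite !inE eqxx ?orbT.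
have uv : [~ gu, gv] = gz.
  rewrite -[RHS](word_eval_gen (pres_gen H5_rels)).
  by apply: H5_comm; rewrite !inE eqxx ?orbT.
have xu : commute gx gu by apply: H5_commute; rewrite !inE eqxx ?orbT.
have xv : commute gx gv by apply: H5_commute; rewrite !inE eqxx ?orbT.
have yu : commute gy gu by apply: H5_commute; rewrite !inE eqxx ?orbT.
have yv : commute gy gv by apply: H5_commute; rewrite !inE eqxx ?orbT.
have xz : commute gx gz by apply: H5_commute; rewrite !inE eqxx ?orbT.
have yz : commute gy gz by apply: H5_commute; rewrite !inE eqxx ?orbT.
have uz : commute gu gz by apply: H5_commute; rewrite !inE eqxx ?orbT.
have vz : commute gv gz by apply: H5_commute; rewrite !inE eqxx ?orbT.
have zx := commute_sym xz; have zy := commute_sym yz.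
have zu := commute_sym uz; have zv := commute_sym vz.
have ux := commute_sym xu; have uy := commute_sym yu.
have vx := commute_sym xv; have vy := commute_sym yv.
case: t => a b c d e; rewrite /normal_form.
elim/ord5_ind: i; rewrite /heis_gen /= !inordK //=;
  rewrite !(add0r, mul0r, subr0, mul1r) ?[(1 + _)%R]addrC ?expzS.
- by rewrite !mulgA.
- have zY : commute (expz gz (- a)%R) (expz gy b * expz gu c * expz gv d).
    apply/commute_sym/commute_expz/commute_sym.
    by do ![apply: commuteM | exact: commute_expz].
  rewrite addrC expzD !mulgA (swap_expz _ xz yz xy) -!mulgA; do 2!congr (_ * _).
  by rewrite !mulgA -zY !mulgA.
- have uX : commute gu (expz gx a * expz gy b).
    by do ![apply: commuteM | exact: commute_expz].
  by rewrite !mulgA -uX !mulgA.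
- have zV : commute (expz gz (- c)%R) (expz gv d).
    by apply/commute_sym/commute_expz/commute_sym/commute_expz.
  have vX : commute gv (expz gx a * expz gy b).
    by do ![apply: commuteM | exact: commute_expz].
  rewrite addrC expzD -!mulgA.
  rewrite [in RHS](mulgA (expz gx a)) [in RHS](mulgA gv) vX.
  rewrite -!mulgA; do 2!congr (_ * _).
  rewrite (mulgA gv (expz gu c)) (swap_expz _ uz vz uv) -!mulgA.
  by do 2!congr (_ * _); rewrite !mulgA zV.
- have zX : commute gz (expz gx a * expz gy b * expz gu c * expz gv d).
    by do ![apply: commuteM | exact: commute_expz].
  by rewrite !mulgA -zX !mulgA.
Qed.

(** The elements [g] of [H5] whose left multiplication is computed correctly by
    normal forms form a subgroup, which contains the generators; applying this
    to the normal form of 1 recovers [g]. *)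
Lemma coordsK : cancel coords normal_form.
Proof.
suff nfM g : forall t, normal_form (coords g * t) = g * normal_form t.
  move=> g; rewrite -[coords g]mulg1 nfM /normal_form /=.
  by rewrite !mulg1.
elim/pres_group_ind: g => [|g h IHg IHh|g IHg|i] t.
- by rewrite (morph_group1 coordsM) !mul1g.
- by rewrite coordsM -!mulgA IHg IHh.
- by apply: (@mulgI _ g); rewrite -IHg mulVKg (morph_groupV coordsM) mulVKg.
- by rewrite coords_gen normal_form_gen.
Qed.

(** * Presentability by products *)

Lemma morph_pres_surj (G : groupType) (X : choiceType)
    (rels : seq (word X * word X)) (f : G -> presented_group rels) :
    {morph f : g h / g * h} -> (forall a, exists g, f g = pres_gen rels a) ->
  range f = [set: presented_group rels].
Proof.
move=> fM fgen; rewrite -subTset => h _.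
elim/pres_group_ind: h => [|_ _ [g _ <-] [h _ <-]|_ [g _ <-]|a].
- by exists 1 => //; exact: morph_group1.
- by exists (g * h).
- by exists g^-1 => //; exact: morph_groupV.
- by have [g <-] := fgen a; exists g.
Qed.

Lemma commuting_mulM (G1 G2 G : groupType) (f1 : G1 -> G) (f2 : G2 -> G) :
    {morph f1 : g h / g * h} -> {morph f2 : g h / g * h} ->
    (forall g1 g2, commute (f1 g1) (f2 g2)) ->
  {morph (fun p : G1 * G2 => f1 p.1 * f2 p.2) : g h / g * h}.
Proof.
move=> f1M f2M f12 [g1 g2] [h1 h2] /=.
by rewrite f1M f2M !mulgA; congr (_ * _); rewrite -!mulgA f12.
Qed.

Lemma commute_word_eval (X Y : choiceType) (G : groupType)
    (f : X -> G) (f' : Y -> G) s t :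
    (forall a b, commute (f a) (f' b)) ->
  commute (word_eval f s) (word_eval f' t).
Proof.
move=> ff'; apply: (word_eval_ind (P := fun g => commute g _)).
- exact/commute_sym/commute1.
- by move=> g h cg ch; apply/commute_sym/commuteM; exact: commute_sym.
- by move=> g cg; apply/commute_sym/commuteV; exact: commute_sym.
move=> a; apply: (word_eval_ind (P := fun h => commute _ h)) => [|g h|g|b] //.
- exact: commute1.
- exact: commuteM.
- exact: commuteV.
Qed.

Definition free2 : groupType := presented_group (Nil (word bool * word bool)).

Definition free2_lift (G : groupType) (a b : G) : free2 -> G :=
  pres_lift (fun i : bool => if i then b else a) (rels := [::]).

Section FreeLift.
Variables (G : groupType) (a b : G).

Lemma free2_liftM : {morph free2_lift a b : g h / g * h}.
Proof. exact: pres_liftM. Qed.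

Lemma free2_lift_gen i : free2_lift a b (pres_gen [::] i) = if i then b else a.
Proof. by rewrite [LHS]pres_lift_class // word_eval_gen. Qed.

Lemma free2_lift_char0 (chi : G -> int) g :
    (forall g h, chi (g * h) = (chi g + chi h)%R) ->
    chi a = 0%R -> chi b = 0%R ->
  chi (free2_lift a b g) = 0%R.
Proof.
move=> chiM chia chib; apply: (word_eval_ind (P := fun h => chi h = 0%R)).
- exact: char1.
- by move=> h k ch ck; rewrite chiM ch ck addr0.
- by move=> h ch; rewrite charV // ch oppr0.
- by case.
Qed.

End FreeLift.

Lemma hx_coordsM g h : hx (coords (g * h)) = (hx (coords g) + hx (coords h))%R.
Proof. by rewrite coordsM. Qed.
Lemma hy_coordsM g h : hy (coords (g * h)) = (hy (coords g) + hy (coords h))%R.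
Proof. by rewrite coordsM. Qed.
Lemma hu_coordsM g h : hu (coords (g * h)) = (hu (coords g) + hu (coords h))%R.
Proof. by rewrite coordsM. Qed.
Lemma hv_coordsM g h : hv (coords (g * h)) = (hv (coords g) + hv (coords h))%R.
Proof. by rewrite coordsM. Qed.

Lemma H5_infinite : infinite_group H5.
Proof.
move=> fin; have : finite_index [set 1 : H5] by exact: finite_image.
apply: (char_infinite_index (g := gx) hx_coordsM) => [//|_ ->|].
  exact: (char1 hx_coordsM).
by rewrite coords_gen /heis_gen /= inordK.
Qed.

Lemma H5_IIPP : IIPP H5.
Proof.
split; first exact: H5_infinite.
pose f1 := free2_lift gx gy; pose f2 := free2_lift gu gv.
have f1M : {morph f1 : g h / g * h} by exact: free2_liftM.
have f2M : {morph f2 : g h / g * h} by exact: free2_liftM.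
have f12 g1 g2 : commute (f1 g1) (f2 g2).
  apply: commute_word_eval => -[] [];
    by apply: H5_commute; rewrite !inE eqxx ?orbT.
have fM := commuting_mulM f1M f2M f12.
pose phi : {multiplicative free2 * free2 -> H5} :=
  HB.pack (fun p : free2 * free2 => f1 p.1 * f2 p.2)
    (isMultiplicative.Build _ _ _ fM).
have phi1 g : phi (g, 1) = f1 g by rewrite /= (morph_group1 f2M) mulg1.
have phi2 g : phi (1, g) = f2 g by rewrite /= (morph_group1 f1M) mul1g.
exists free2, free2, phi; split.
- rewrite (_ : range phi = setT).
    apply: (sub_finite_set (B := [set setT])); last exact: finite_set1.
    move=> _ [g _ <-]; apply/seteqP; split=> // h _.
    by exists (g^-1 * h); rewrite // mulVKg.
  apply: (morph_pres_surj fM); elim/ord5_ind.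
  + exists (pres_gen _ false, 1); apply: etrans (phi1 _) _.
    by rewrite /f1 free2_lift_gen.
  + exists (pres_gen _ true, 1); apply: etrans (phi1 _) _.
    by rewrite /f1 free2_lift_gen.
  + exists (1, pres_gen _ false); apply: etrans (phi2 _) _.
    by rewrite /f2 free2_lift_gen.
  + exists (1, pres_gen _ true); apply: etrans (phi2 _) _.
    by rewrite /f2 free2_lift_gen.
  + exists ([~ pres_gen _ false, pres_gen _ true], 1); apply: etrans (phi1 _) _.
    rewrite !f1M !(morph_groupV f1M) /f1 !free2_lift_gen.
    rewrite -[RHS]word_eval_gen.
    by apply: H5_comm; rewrite !inE eqxx ?orbT.
- apply: (char_infinite_index (g := gu) hu_coordsM).
  + by exists 1 => //; rewrite phi1 (morph_group1 f1M).
  + move=> _ [g _ <-]; rewrite phi1; apply: (free2_lift_char0 _ hu_coordsM);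
      by rewrite coords_gen /heis_gen /= inordK.
  + by rewrite coords_gen /heis_gen /= inordK.
- apply: (char_infinite_index (g := gx) hx_coordsM).
  + by exists 1 => //; rewrite phi2 (morph_group1 f2M).
  + move=> _ [g _ <-]; rewrite phi2; apply: (free2_lift_char0 _ hx_coordsM);
      by rewrite coords_gen /heis_gen /= inordK.
  + by rewrite coords_gen /heis_gen /= inordK.
Qed.

(** * Irreducibility *)

Lemma coords_gen_expg i n : let s := coords (pres_gen H5_rels i ^+ n) in
  let t := heis_gen i in
  [/\ hx s = hx t *+ n, hy s = hy t *+ n,
      hu s = hu t *+ n & hv s = hv t *+ n]%R.
Proof.
by rewrite /= (charX hx_coordsM) (charX hy_coordsM) (charX hu_coordsM)
           (charX hv_coordsM) coords_gen.
Qed.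

(** An element that commutes with all of [K] is orthogonal to positive multiples
    of the four basis vectors, and the symplectic form is nondegenerate. *)
Lemma centralizer_finite_index (K : set H5) g :
    group_closed (mem K) -> finite_index K -> (forall k, K k -> commute g k) ->
  exists m, coords g = hcenter m.
Proof.
move=> Kgrp Kfin gK; exists (hz (coords g)); apply: hcenterP.
have ortho i : exists2 n, (0 < n)%N &
    symp (coords g) (coords (pres_gen H5_rels i ^+ n)) = 0%R.
  have [n n_gt0 Kn] := finite_index_expg (pres_gen H5_rels i) Kgrp Kfin.
  by exists n => //; apply/heis_commuteP; rewrite /commute -!coordsM gK.
have gen_symp i : symp (coords g) (heis_gen i) = 0%R.
  have [n n_gt0] := ortho i; rewrite /symp.
  have [/= -> -> -> ->] := coords_gen_expg i n.
  rewrite !mulrnAr -!mulrnBl -mulrnDl => /eqP.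
  by rewrite mulrn_eq0 -leqn0 leqNgt n_gt0 /= => /eqP.
move: (gen_symp (inord 0)) (gen_symp (inord 1)).
move: (gen_symp (inord 2)) (gen_symp (inord 3)).
rewrite /symp /heis_gen /= !inordK //= => *; split; lia.
Qed.

(** Here [f] plays the role of the inclusion of one factor of [K]; the last
    hypothesis holds with [c] in the other factor. If [G] is not abelian, a
    nontrivial commutator is the required element; otherwise [f g] centralizes
    [K] for all [g]. *)
Lemma factor_meets_center (K : set H5) (G : groupType) (f : G -> H5) :
    group_closed (mem K) -> finite_index K -> infinite_group G ->
    {morph f : g h / g * h} ->
    (forall k, K k -> exists g c, k = f g * c /\ forall h, commute (f h) c) ->
  exists2 g, g <> 1 & exists m, coords (f g) = hcenter m.
Proof.
move=> Kgrp Kfin Ginf fM Kfactor.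
have [comG|] := pselect (forall g h : G, commute g h); last first.
  move=> /existsNP[g /existsNP[h ngh]]; exists [~ g, h].
    by move/eqP/commgP.
  rewrite !fM !(morph_groupV fM) !coordsM !(morph_groupV coordsM).
  exact: heis_commg.
have [g g1] : exists g : G, g <> 1.
  apply: contrapT => /forallNP G1; apply: Ginf.
  apply: (sub_finite_set (B := [set 1])); last exact: finite_set1.
  by move=> g _; exact: contrapT (G1 g).
exists g => //; apply: (centralizer_finite_index Kgrp Kfin).
move=> _ /Kfactor[h [c [-> fc]]].
by apply: commuteM => //; rewrite /commute -!fM comG.
Qed.

Lemma H5_irreducible : irreducible H5.
Proof.
move=> [K [Kgrp Kfin [G1 [G2 [psi [G1inf G2inf [_ psi_inj psi_surj]]]]]]].
have psiI : injective psi by move=> p q; apply: psi_inj; rewrite inE.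
have psiM : {morph psi : p q / p * q} by exact: gmulfM.
pose f1 g := psi (g, 1); pose f2 g := psi (1, g).
have f1M : {morph f1 : g h / g * h}.
  by move=> g h; rewrite /f1 -psiM -[X in psi (_, X)]mulg1.
have f2M : {morph f2 : g h / g * h}.
  by move=> g h; rewrite /f2 -psiM -[X in psi (X, _)]mulg1.
have psi12 g h : psi (g, h) = f1 g * f2 h.
  by rewrite /f1 /f2 -psiM -[g in LHS]mulg1 -[h in LHS]mul1g.
have psi21 g h : psi (g, h) = f2 h * f1 g.
  by rewrite /f1 /f2 -psiM -[g in LHS]mul1g -[h in LHS]mulg1.
have f12 g h : commute (f1 g) (f2 h) by rewrite /commute -psi12 psi21.
have [g g1 [m gm]] : exists2 g, g <> 1 & exists m, coords (f1 g) = hcenter m.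
  apply: (factor_meets_center Kgrp Kfin G1inf f1M) => _ /psi_surj[[g h] _ <-].
  by exists g, (f2 h); split.
have [h h1 [k hk]] : exists2 h, h <> 1 & exists m, coords (f2 h) = hcenter m.
  apply: (factor_meets_center Kgrp Kfin G2inf f2M) => _ /psi_surj[[g' h] _ <-].
  by exists h, (f1 g'); split => // h'; apply/commute_sym.
have m0 : m <> 0%R.
  move=> m0; apply: g1; have /psiI[//] : psi (g, 1) = psi 1.
  apply: (can_inj coordsK); rewrite (morph_group1 psiM) (morph_group1 coordsM).
  by rewrite -/(f1 g) gm m0.
have k0 : k <> 0%R.
  move=> k0; apply: h1; have /psiI[//] : psi (1, h) = psi 1.
  apply: (can_inj coordsK); rewrite (morph_group1 psiM) (morph_group1 coordsM).
  by rewrite -/(f2 h) hk k0.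
(* The image of this pair is z^(m k) z^(- k m). *)
have : psi (expz g k, expz h (- m)%R) = psi 1.
  apply: (can_inj coordsK); rewrite psi12 coordsM.
  rewrite (morph_expz _ f1M) (morph_expz _ f2M).
  rewrite !(morph_expz _ coordsM) gm hk !expz_hcenter -hcenterM.
  by rewrite (morph_group1 psiM) (morph_group1 coordsM); congr hcenter; ring.
case/psiI => gk _.
have : coords (f1 (expz g k)) = 1.
  by rewrite gk (morph_group1 f1M) (morph_group1 coordsM).
rewrite (morph_expz _ f1M) (morph_expz _ coordsM) gm expz_hcenter => -[/eqP].
by rewrite mulf_eq0 => /orP[] /eqP.
Qed.

Theorem lemma8p1 : IIPP H5 /\ irreducible H5.
Proof. by split; [exact: H5_IIPP | exact: H5_irreducible]. Qed.
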